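(* Let $\mathcal{U}$ be a universal sofic group. Then for every $g\in\mathcal{U}$ and every positive integer $p$ there exists $x\in\mathcal{U}$ with $x^p=g$.
   Context: $S_n$ denotes the group of all permutations of $\{1,\dots,n\}$, and for $f,g\in S_n$ the normalized Hamming distance is $h(f,g)=\frac{|\{a\in\{1,\dots,n\}: f(a)\ne g(a)\}|}{n}$, a bi-invariant metric on $S_n$. Universal sofic group (in the sense of Elek and Szabó): given a nonprincipal ultrafilter $\omega$ on the set of positive integers, the associated universal sofic group is the quotient group $\mathcal{U}=\prod_{n\ge1}S_n/N_\omega$, where $N_\omega$ is the normal subgroup of all sequences $(f_n)_{n\ge 1}\in\prod_{n\ge1}S_n$ with $\lim_{n\to\omega}h(f_n,\mathrm{id})=0$ (limit along $\omega$). *)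

(* Defs.v *)
From HB Require Import structures.
From mathcomp Require Import all_boot all_order all_algebra all_fingroup.
From mathcomp Require Import all_classical all_reals all_analysis.

Set Implicit Arguments.
Unset Strict Implicit.
Unset Printing Implicit Defensive.

Import Order.TTheory GRing.Theory Num.Theory.
Import numFieldNormedType.Exports.

Local Open Scope classical_set_scope.
Local Open Scope quotient_scope.
Local Open Scope ring_scope.

(* The direct product of a possibly infinite family of groups, under an alias *)
(* so that the pointwise group structure does not apply to every function.    *)
Definition prodGroup (I : Type) (G : I -> groupType) : Type := forall i, G i.

Section DirectProduct.
Local Open Scope group_scope.
Variables (I : Type) (G : I -> groupType).
Implicit Types f g : prodGroup G.

HB.instance Definition _ := Choice.copy (prodGroup G) (forall i, G i).

Definition prodg_mul f g : prodGroup G := fun i => f i * g i.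
Definition prodg_one : prodGroup G := fun=> 1.
Definition prodg_inv f : prodGroup G := fun i => (f i)^-1.

Let prodg_mulA : associative prodg_mul.
Proof. by move=> f g h; apply: functional_extensionality_dep => i; rewrite /prodg_mul mulgA. Qed.
Let prodg_mul1 : left_id prodg_one prodg_mul.
Proof. by move=> f; apply: functional_extensionality_dep => i; rewrite /prodg_mul mul1g. Qed.
Let prodg_mulr1 : right_id prodg_one prodg_mul.
Proof. by move=> f; apply: functional_extensionality_dep => i; rewrite /prodg_mul mulg1. Qed.
Let prodg_mulV : left_inverse prodg_one prodg_inv prodg_mul.
Proof. by move=> f; apply: functional_extensionality_dep => i; rewrite /prodg_mul mulVg. Qed.
Let prodg_mulrV : right_inverse prodg_one prodg_inv prodg_mul.
Proof. by move=> f; apply: functional_extensionality_dep => i; rewrite /prodg_mul mulgV. Qed.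

HB.instance Definition _ := isGroup.Build (prodGroup G)
  prodg_mulA prodg_mul1 prodg_mulr1 prodg_mulV prodg_mulrV.

End DirectProduct.

Record normalSubgroup (G : groupType) := NormalSubgroup {
  nsubg_pred :> {pred G};
  nsubg_closed : group_closed nsubg_pred;
  nsubgJ : {in nsubg_pred, forall x y, (x ^ y)%g \in nsubg_pred}
}.

Section QuotientGroup.
Local Open Scope group_scope.
Variables (G : groupType) (N : normalSubgroup G).
Implicit Types x y z : G.

Let nsubg1 : 1 \in N.
Proof. by case: (nsubg_closed N). Qed.
Let nsubgM x y : x \in N -> y \in N -> x * y \in N.
Proof. exact: (group_closedM (nsubg_closed N)). Qed.
Let nsubgV x : x \in N -> x^-1 \in N.
Proof. exact: (group_closedV (nsubg_closed N)). Qed.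

Definition coset_rel x y := x^-1 * y \in N.

Let coset_rel_refl : reflexive coset_rel.
Proof. by move=> x; rewrite /coset_rel mulVg nsubg1. Qed.
Let coset_rel_sym : symmetric coset_rel.
Proof. by move=> x y; apply/idP/idP => /nsubgV; rewrite /coset_rel invgM invgK. Qed.
Let coset_rel_trans : transitive coset_rel.
Proof.
move=> y x z xy yz; rewrite /coset_rel.
by have := nsubgM xy yz; rewrite -mulgA mulKVg.
Qed.

Canonical coset_equiv :=
  EquivRel coset_rel coset_rel_refl coset_rel_sym coset_rel_trans.

Definition quotGroup := {eq_quot coset_equiv}.

HB.instance Definition _ := Choice.on quotGroup.
HB.instance Definition _ := EqQuotient.on quotGroup.

Definition quot_one : quotGroup := \pi_quotGroup 1.
Definition quot_mul := lift_op2 quotGroup (fun x y : G => x * y).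
Definition quot_inv := lift_op1 quotGroup (fun x : G => x^-1).

Let coset_repr x : x^-1 * generic_quotient.repr (\pi_quotGroup x) \in N.
Proof. by have /esym/eqmodP := reprK (\pi_quotGroup x). Qed.

Lemma pi_quot_mul :
  {morph \pi_quotGroup : x y / (x * y)%g >-> quot_mul x y}.
Proof.
move=> x y; unlock quot_mul; apply/eqmodP; rewrite /= /coset_rel.
have := coset_repr y; have := coset_repr x.
set x' := generic_quotient.repr _; set y' := generic_quotient.repr _ => xx yy.
have -> : (x * y)^-1 * (x' * y') = (x^-1 * x') ^ y * (y^-1 * y').
  by rewrite /conjg invgM !mulgA mulgK.
by apply: nsubgM => //; apply: nsubgJ.
Qed.
Canonical pi_quot_mul_morph := PiMorph2 pi_quot_mul.

Lemma pi_quot_inv : {morph \pi_quotGroup : x / x^-1 >-> quot_inv x}.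
Proof.
move=> x; unlock quot_inv; apply/eqmodP; rewrite /= /coset_rel invgK.
have /nsubgV := coset_repr x; rewrite invgM invgK.
set x' := generic_quotient.repr _ => xx.
have -> : x * x'^-1 = (x'^-1 * x) ^ x^-1 by rewrite /conjg invgK !mulgA mulgK.
exact: nsubgJ.
Qed.
Canonical pi_quot_inv_morph := PiMorph1 pi_quot_inv.

Let quot_mulA : associative quot_mul.
Proof.
by elim/quotW=> x; elim/quotW=> y; elim/quotW=> z; rewrite -!pi_quot_mul mulgA.
Qed.
Let quot_mul1 : left_id quot_one quot_mul.
Proof. by elim/quotW=> x; rewrite -pi_quot_mul mul1g. Qed.
Let quot_mulr1 : right_id quot_one quot_mul.
Proof. by elim/quotW=> x; rewrite -pi_quot_mul mulg1. Qed.
Let quot_mulV : left_inverse quot_one quot_inv quot_mul.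
Proof. by elim/quotW=> x; rewrite -pi_quot_inv -pi_quot_mul mulVg. Qed.
Let quot_mulrV : right_inverse quot_one quot_inv quot_mul.
Proof. by elim/quotW=> x; rewrite -pi_quot_inv -pi_quot_mul mulgV. Qed.

HB.instance Definition _ := isGroup.Build quotGroup
  quot_mulA quot_mul1 quot_mulr1 quot_mulV quot_mulrV.

End QuotientGroup.

Record nonprincipalUltrafilter (T : Type) := NonprincipalUltrafilter {
  nuf_set :> set_system T;
  nuf_ultra : UltraFilter nuf_set;
  nuf_nonprincipal : forall t : T, nuf_set <> principal_filter t
}.

#[global] Existing Instance nuf_ultra.

Definition posnat : Type := {n : nat | (0 < n)%N}.

Definition hamming (R : realType) (n : nat) (f g : 'S_n) : R :=
  #|[set a | f a != g a]%SET|%:R / n%:R.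

Definition permSeq : groupType := prodGroup (fun n : posnat => 'S_(val n)).

Section UniversalSofic.
Variables (R : realType) (w : nonprincipalUltrafilter posnat).

Definition null_seqs : {pred permSeq} :=
  fun f => `[< hamming R (f n) 1%g @[n --> nuf_set w] --> (0 : R) >].

Let hamming_ge0 n (f g : 'S_n) : 0 <= hamming R f g.
Proof. by rewrite /hamming divr_ge0. Qed.

Let null_seqs1 : (1%g : permSeq) \in null_seqs.
Proof.
apply/asboolP.
have -> : (fun n : posnat => hamming R ((1%g : permSeq) n) 1%g) = fun=> 0.
  apply/funext => n; rewrite /hamming (_ : [set _ | _]%SET = finset.set0) ?cards0 ?mul0r//.
  by apply/setP => a; rewrite !inE eqxx.
exact: cvg_cst.
Qed.

Let null_seqsV : invg_closed null_seqs.
Proof.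
move=> f /asboolP f0; apply/asboolP.
rewrite (_ : (fun n => _) = fun n => hamming R (f n) 1%g)//.
apply/funext => n; rewrite /hamming; congr (_%:R / _).
by apply: eq_card => a; rewrite !inE -(inj_eq (@perm_inj _ (f n))) permKV !perm1 eq_sym.
Qed.

Let null_seqsM : mulg_closed null_seqs.
Proof.
move=> f g /asboolP f0 /asboolP g0; apply/asboolP.
have fg0 : hamming R (f n) 1%g + hamming R (g n) 1%g @[n --> nuf_set w] --> (0 : R).
  by rewrite -[0]addr0; apply: cvgD.
apply: (squeeze_cvgr _ (cvg_cst (0 : R)) fg0).
apply: nearW => n; rewrite hamming_ge0/= /hamming -mulrDl.
rewrite ler_pM2r ?invr_gt0 ?ltr0n ?(valP n)// -natrD ler_nat.
rewrite (leq_trans _ (leq_card_setU _ _))//; apply: subset_leq_card.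
apply/fintype.subsetP => a; rewrite !inE !perm1; apply: contraR.
by rewrite negb_or !negbK permM => /andP[/eqP -> /eqP ->].
Qed.

Let null_seqsJ : {in null_seqs, forall f, forall g, (f ^ g)%g \in null_seqs}.
Proof.
move=> f /asboolP f0 g; apply/asboolP.
rewrite (_ : (fun n => _) = fun n => hamming R (f n) 1%g)//.
apply/funext => n; rewrite /hamming; congr (_%:R / _).
rewrite -[RHS](card_imset _ (@perm_inj _ (g n))).
apply: eq_card => a.
rewrite -(permKV (g n) a) mem_imset ?inE ?perm1; last exact: perm_inj.
by rewrite (permJ (f n) (g n)) (inj_eq perm_inj).
Qed.

Let null_seqs_group : group_closed null_seqs.
Proof.
by split=> // f g f0 g0; apply: null_seqsM => //; apply: null_seqsV.
Qed.

Definition null_subgroup : normalSubgroup permSeq :=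
  NormalSubgroup null_seqs_group null_seqsJ.

Definition universalSofic : groupType := quotGroup null_subgroup.

End UniversalSofic.

(* Main.v *)
(* It suffices to find, for every f in S_n, some x with x^p equal to f outside *)
(* o(n) points. Any p cycles of f of equal length l form the p-th power of a   *)
(* single cycle of length p * l. Once no such p-tuple of cycles remains, at    *)
(* most K * p cycles are shorter than K and at most n / K are not, so few      *)
(* cycles are left; concatenating them gives one long cycle that follows f     *)
(* except at their ends, and cutting it to length 1 mod p makes it a p-th      *)
(* power.                                                                      *)
Require Import Defs.
From mathcomp Require Import all_boot all_order all_algebra all_fingroup.
From mathcomp Require Import zify.

Set Implicit Arguments.
Unset Strict Implicit.
Unset Printing Implicit Defensive.

(** The finite statement is [approximate_root]. With [Y] all [n] points, it gives an [x] whose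
    [p]-th power differs from [f] on a fraction at most [1/K + (K + 1) * p / n] of them, for any
    [K > 0]. Exact roots come from [equal_porbits_root]; [porbits_listing], [listing_root] and
    [card_trivIset_le] handle the leftover cycles. A nonprincipal ultrafilter forces [n] past every
    bound ([nonprincipal_ge]), so the error tends to 0 and the classes agree in the quotient. *)

Section ApproximateRoots.
Variable T : finType.
Implicit Types (f c : {perm T}) (s A : seq T) (Y Z E : {set T}).

(** * Exact roots on cycles of equal length *)

Lemma perm_onX Y c n : perm_on Y c -> perm_on Y (c ^+ n)%g.
Proof.
move=> cY; elim: n => [|n IHn]; first exact: perm_on1.
by rewrite expgSr; apply: perm_onM.
Qed.

Lemma seq_cycle s : uniq s ->
  exists2 c, perm_on [set:: s] c &
    forall x0 k j, k < size s ->
      (c ^+ j)%g (nth x0 s k) = nth x0 s ((k + j) %% size s).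
Proof.
move=> Us; pose c := perm (can_inj (prev_next Us)).
have c_nth x0 k : k < size s -> c (nth x0 s k) = nth x0 s (k.+1 %% size s).
  move=> ks; rewrite permE next_nth mem_nth// index_uniq//.
  (* At the last entry [next] returns the default of [nth], which is the head: this is the
     wraparound. *)
  case: s Us c ks => // y s Us _; rewrite /= ltnS leq_eqVlt => /orP[/eqP->|ks].
    by rewrite modnn nth_default.
  by rewrite modn_small ?ltnS// (set_nth_default x0).
exists c.
  by apply/subsetP => a; rewrite !inE permE next_nth; case: ifP => //; rewrite eqxx.
move=> x0 k j ks; elim: j => [|j IHj]; first by rewrite expg0 perm1 addn0 modn_small.
rewrite expgSr permM IHj c_nth ?ltn_mod ?(leq_ltn_trans _ ks)//.
by rewrite -(addn1 (_ %% _)) modnDml addn1 addnS.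
Qed.

(* With A = a_0, ..., a_(p-1), the root is the cycle                         *)
(* a_0 ... a_(p-1) (f a_0) ... (f a_(p-1)) (f^2 a_0) ... of length p * l.    *)
Lemma equal_porbits_root f l A : 0 < size A ->
  uniq (map (porbit f) A) -> {in A, forall a, #|porbit f a| = l} ->
  exists Z x, [/\ perm_on Z x,
    {in Z, forall z, (x ^+ size A)%g z = f z /\ f z \in Z},
    {in Z, forall z, exists2 a, a \in A & z \in porbit f a} & Z != set0].
Proof.
move=> A0 UA Al; set p := size A.
have [a0 a0A] : exists a0, a0 \in A by case: A A0 {UA Al p} => // a A; exists a; rewrite mem_head.
have l0 : 0 < l by rewrite -(Al _ a0A) lt0n card_porbit_neq0.
(* Entry [k] of the interleaved cycle; advancing [k] by [p] applies [f]. *)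
pose F k := (f ^+ (k %/ p))%g (nth a0 A (k %% p)).
have FA k : nth a0 A (k %% p) \in A by rewrite mem_nth ?ltn_mod.
have fl k : (f ^+ l)%g (nth a0 A (k %% p)) = nth a0 A (k %% p).
  by rewrite permX -(Al _ (FA k)) iter_porbit.
have FD k : F (k + p) = f (F k).
  by rewrite /F modnDr divnDr ?dvdnn// divnn A0 addn1 expgSr permM.
(* Since [f ^+ l] fixes every entry of [A], closing up after [p * l] steps is consistent with
   [FD]. *)
have FM k : F (k %% (p * l)) = F k.
  rewrite [in RHS](divn_eq k (p * l)); elim: (k %/ _) => [//|q ->].
  rewrite mulSn -addnA; move: (q * _ + _) => r.
  rewrite /F mulnC modnMDl divnMDl// expgD permM.
  by rewrite fl.
have orbF k : porbit f (F k) = porbit f (nth a0 A (k %% p)) by rewrite porbit_perm.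
pose s := mkseq F (p * l).
(* Equal entries lie in one cycle, so their indices agree mod [p]; then injectivity of the first [l]
   iterates makes the quotients agree. *)
have Us : uniq s.
  apply/mkseq_uniqP => i j; rewrite !inE => ipl jpl Fij.
  have ijp : i %% p = j %% p.
    apply/eqP; have := congr1 (porbit f) Fij; rewrite !orbF => /eqP.
    by rewrite -!(nth_map _ (porbit f a0)) ?ltn_mod// nth_uniq ?size_map ?ltn_mod.
  rewrite (divn_eq i p) (divn_eq j p) ijp; congr (_ * _ + _).
  move: Fij; rewrite /F ijp !permX => Fij; apply/eqP.
  have := uniq_traject_porbit f (nth a0 A (j %% p)); rewrite (Al _ (FA j)) => Ut.
  have ltl k : k < p * l -> k %/ p < l by rewrite ltn_divLR// mulnC.
  rewrite -(nth_uniq (nth a0 A (j %% p)) _ _ Ut) ?size_traject ?ltl//.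
  by rewrite !nth_traject ?ltl// Fij.
have sF k : F k \in s.
  by rewrite -FM -(@nth_mkseq _ a0 F (p * l)) ?mem_nth ?size_mkseq ?ltn_mod ?muln_gt0 ?A0.
have [c con cE] := seq_cycle Us.
exists [set:: s], c; split=> //.
- move=> z; rewrite inE => /(nthP a0)[k]; rewrite size_mkseq => kpl <-.
  rewrite cE ?size_mkseq// !nth_mkseq ?ltn_mod ?muln_gt0 ?A0//.
  by rewrite FM FD; split=> //; rewrite inE -FD sF.
- move=> z; rewrite inE => /(nthP a0)[k]; rewrite size_mkseq => kpl <-.
  by rewrite nth_mkseq//; exists (nth a0 A (k %% p)) => //; apply: mem_porbit.
- by apply/set0Pn; exists (F 0); rewrite inE sF.
Qed.

(** * One long cycle through the leftover cycles *)

(** The cycles are cut open and concatenated; [E] collects the last point of each, the only places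
    where the successor in [s] may fail to be the image under [f]. *)
Lemma porbits_listing f A : uniq (map (porbit f) A) ->
  exists s E, [/\ uniq s,
    forall z, (z \in s) = has (fun a => z \in porbit f a) A,
    #|E| <= size A &
    forall x0 k, k < size s -> nth x0 s k \notin E ->
      k.+1 < size s /\ nth x0 s k.+1 = f (nth x0 s k)].
Proof.
elim: A => [_|a A IHA /= /andP[aA /IHA[s [E [Us sA EA sE]]]]].
  by exists [::], set0; split; rewrite // cards0.
pose l := #|porbit f a|; pose t := traject f a l.
have l0 : 0 < l by rewrite lt0n card_porbit_neq0.
exists (t ++ s), (iter l.-1 f a |: E); split.
- rewrite cat_uniq uniq_traject_porbit Us andbT; apply/hasPn => z.
  rewrite sA => /hasP[b bA zb]; apply: contra aA => /=.
  rewrite -porbit_traject -eq_porbit_mem => /eqP <-.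
  by move: zb; rewrite -eq_porbit_mem => /eqP ->; apply: map_f.
- by move=> z; rewrite mem_cat sA -porbit_traject.
- by rewrite cardsU1 /= -add1n leq_add ?leq_b1.
- move=> x0 k; rewrite !inE negb_or size_cat size_traject !nth_cat size_traject => kl.
  case: ltnP => [klt|lek].
    rewrite (set_nth_default a) ?size_traject// nth_traject// => /andP[ka _].
    have kl1 : k.+1 < l.
      rewrite ltn_neqAle klt andbT; apply: contra ka => /eqP <-.
      by rewrite eqxx.
    by rewrite kl1 (set_nth_default a) ?size_traject// nth_traject// ltn_addr.
  rewrite [k.+1 < l]ltnNge (leqW lek)/= => /andP[_ kE].
  have [] := sE x0 (k - l) _ kE; first by rewrite ltn_subLR.
  by rewrite -subSn// ltn_subLR// ltnW.
Qed.

Lemma listing_root f p s E : 0 < p -> uniq s ->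
  (forall x0 k, k < size s -> nth x0 s k \notin E ->
      k.+1 < size s /\ nth x0 s k.+1 = f (nth x0 s k)) ->
  exists2 x, perm_on [set:: s] x &
    #|[set a in s | (x ^+ p)%g a != f a]| <= #|E| + p.
Proof.
case: s => [|a0 s'] p0.
  exists 1%g; first exact: perm_on1.
  by rewrite (_ : [set _ in _ | _] = set0) ?cards0//; apply/setP => a; rewrite !inE.
move: (a0 :: s') (isT : 0 < size (a0 :: s')) => {}s s_gt0 Us sE.
(* [N] is the largest number at most [size s] that is 1 mod [p]. *)
pose q := (size s).-1 %/ p; pose N := q * p + 1.
have Ns : N <= size s by have := leq_divM (size s).-1 p; rewrite /N /q; lia.
have sN : size s < N + p by have := ltn_ceil (size s).-1 p0; rewrite /N /q; lia.
have size_t : size (take N s) = N by rewrite size_takel.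
have [c con cE] := seq_cycle (take_uniq N Us).
(* The exponent inverts [p] modulo the length [N] of [c]: [p * (q * (p - 1) + 1) = (p - 1) * N + 1],
   so the [p]-th power is [c]. *)
exists (c ^+ (q * p.-1 + 1))%g.
  apply: (subset_trans (B := [set:: take N s])); last first.
    by apply/subsetP => a; rewrite !inE => /mem_take.
  exact: perm_onX.
(* Besides [E], errors occur only at the last entry of the shortened cycle and at the entries cut
   off, at most [p] in all. *)
apply: (@leq_trans #|E :|: [set:: drop N.-1 s]|); last first.
  rewrite (leq_trans (leq_card_setU _ _))// leq_add2l cardsE.
  by rewrite (leq_trans (card_size _))// size_drop; lia.
apply/subset_leq_card/subsetP => a; rewrite !inE => /andP[/(nthP a0)[k ks <-]].
apply: contraR; rewrite negb_or => /andP[kE kd].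
have kN : k.+1 < N.
  rewrite ltnNge; apply: contra kd => Nk.
  by rewrite -(subnKC (_ : N.-1 <= k)) -?nth_drop ?mem_nth ?size_drop; lia.
have [_ <-] := sE _ _ ks kE.
rewrite -expgM -(@nth_take N)// 1?ltnW// cE ?size_t 1?ltnW//.
rewrite (_ : k + _ = p.-1 * N + k.+1); last by rewrite /N; nia.
by rewrite modnMDl modn_small// nth_take.
Qed.

(** * Counting cycles and combining both constructions *)

(** Blocks with at least [K] points pay for themselves in the cover; there are at most [K * p]
    smaller ones, each charged [K]. *)
Lemma card_trivIset_le (Q : {set {set T}}) p K : trivIset Q ->
  (forall l, #|[set O in Q | #|O| == l]| <= p) ->
  K * #|Q| <= #|cover Q| + K * K * p.
Proof.
move=> /eqP <- Qp; rewrite -sum1_card big_distrr/=.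
rewrite (bigID (fun O : {set T} => #|O| < K))/= addnC leq_add//.
  rewrite [leqRHS](bigID (fun O : {set T} => #|O| < K))/= addnC.
  rewrite (leq_trans _ (leq_addr _ _))//; apply: leq_sum => O.
  by rewrite -leqNgt muln1 => /andP[].
rewrite muln1 sum_nat_const mulnC -mulnA leq_mul2l -sum1_card; apply/orP; right.
apply: (@leq_trans (\sum_(O in Q) \sum_(l < K) (#|O| == l))).
  rewrite [leqRHS](bigID (fun O : {set T} => #|O| < K))/=.
  rewrite (leq_trans _ (leq_addr _ _))//; apply: leq_sum => O /andP[_ OK].
  by rewrite (bigD1 (Ordinal OK))//= eqxx.
rewrite exchange_big/= -[leqRHS]/(K * p) -[K in leqRHS]card_ord -sum_nat_const.
apply: leq_sum => l _; rewrite (leq_trans _ (Qp l))// -sum1_card.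
by rewrite -big_mkcondr/= leq_eqVlt; apply/orP; left; apply/eqP/eq_bigl => O; rewrite inE.
Qed.

(** Induction on the size of the stable set [Y]: while some length occurs [p] times, remove [p] such
    cycles at no cost; then list the rest. *)
Lemma approximate_root f p K Y : 0 < p -> {in Y, forall a, f a \in Y} ->
  exists2 x : {perm T}, perm_on Y x &
    K * #|[set a in Y | (x ^+ p)%g a != f a]| <= #|Y| + K * p + K * K * p.
Proof.
move=> p0; have [n] := ubnP #|Y|; elim: n => // n IHn in Y *; rewrite ltnS => Yn Yf.
have Yorb a b : a \in Y -> b \in porbit f a -> b \in Y.
  move=> aY /porbitP[i ->]; elim: i => [|i IHi]; first by rewrite expg0 perm1.
  by rewrite expgSr permM Yf.
pose Q := [set O in porbits f | O \subset Y].
have QA (Os : seq {set T}) : {subset Os <= Q} ->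
    exists2 A, {subset A <= Y} & map (porbit f) A = Os.
  elim: Os => [|O Os IH] OsQ; first by exists [::].
  have [O' O'Q|A AY AOs] := IH; first by rewrite OsQ// inE O'Q orbT.
  have := OsQ O (mem_head _ _); rewrite inE => /andP[/imsetP[a _ ->] aY].
  exists (a :: A); last by rewrite /= AOs.
  move=> b; rewrite inE => /predU1P[->|/AY//].
  by apply: (fintype.subsetP aY); rewrite porbit_id.
case: (pickP (fun l : 'I_#|T|.+1 => p <= #|[set O in Q | #|O| == l]|)) => [l pl|Qp].
  pose Os := take p (enum [set O in Q | #|O| == l]).
  have sOs : size Os = p by rewrite size_takel// -cardE.
  have OsQ O : O \in Os -> O \in [set O in Q | #|O| == l].
    by move=> /mem_take; rewrite mem_enum.
  have [|A AY AOs] := QA Os; first by move=> O /OsQ; rewrite inE => /andP[].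
  have sA : size A = p by rewrite -sOs -AOs size_map.
  have UA : uniq (map (porbit f) A) by rewrite AOs take_uniq ?enum_uniq.
  have Al : {in A, forall a, #|porbit f a| = l}.
    move=> a aA; apply/eqP.
    have : porbit f a \in Os by rewrite -AOs map_f.
    by move/OsQ; rewrite inE => /andP[].
  have [|Z [z [zon zZ ZA Z0]]] := equal_porbits_root _ UA Al; first by rewrite sA.
  have ZY : Z \subset Y.
    by apply/fintype.subsetP => b /ZA[a /AY aY]; apply: Yorb.
  (* An injective map sending a finite set into itself is onto it, so [Y :\: Z] is stable too. *)
  have fZ a : (f a \in Z) = (a \in Z).
    have fZZ : f @: Z = Z.
      apply/eqP; rewrite eqEcard card_imset ?leqnn ?andbT; last exact: perm_inj.
      by apply/fintype.subsetP => _ /imsetP[b /zZ[_ ?] ->].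
    by rewrite -{1}fZZ mem_imset//; apply: perm_inj.
  have [| |y yon yE] := IHn (Y :\: Z).
  - rewrite (leq_trans _ Yn)// cardsD (finset.setIidPr ZY).
    by have := subset_leq_card ZY; move: Z0; rewrite -card_gt0; lia.
  - by move=> a; rewrite !inE fZ => /andP[-> /Yf].
  exists (z * y)%g.
    by apply: perm_onM; [apply: subset_trans zon ZY|apply: subset_trans yon (subsetDl _ _)].
  (* Disjoint supports: the power of the product splits. *)
  have zyC : commute z y.
    apply: perm_onC zon yon _; rewrite -setI_eq0; apply/eqP/setP => a.
    by rewrite !inE; case: (a \in Z).
  apply: leq_trans (leq_trans yE _); last first.
    by rewrite !leq_add2r subset_leq_card// subsetDl.
  rewrite leq_mul2l subset_leq_card ?orbT//; apply/fintype.subsetP => a.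
  rewrite !inE => /andP[aY]; rewrite aY andbT expgMn// permM.
  have [aZ|aZ] := boolP (a \in Z).
    have [zf fZa] := zZ _ aZ.
    by rewrite sA in zf; rewrite zf /= (out_perm (perm_onX p yon)) ?inE ?fZa ?eqxx.
  by rewrite (out_perm (perm_onX p zon)).
have [|A AY AQ] := QA (enum Q); first by move=> O; rewrite mem_enum.
have [|s [E [Us sA EA sE]]] := @porbits_listing f A; first by rewrite AQ enum_uniq.
have [x xon xE] := listing_root p0 Us sE.
have sY : [set:: s] = Y.
  apply/setP => a; rewrite inE sA; apply/hasP/idP => [[b /AY bY]|aY]; first exact: Yorb.
  have : porbit f a \in map (porbit f) A.
    rewrite AQ mem_enum inE imset_f//=; apply/fintype.subsetP => b; exact: Yorb.
  by move=> /mapP[b bA ab]; exists b; rewrite // -ab porbit_id.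
exists x; first by rewrite -sY.
have -> : [set a in Y | (x ^+ p)%g a != f a] = [set a in s | (x ^+ p)%g a != f a].
  by apply/setP => a; rewrite -sY !inE.
have sQ : size A = #|Q| by rewrite -(size_map (porbit f)) AQ -cardE.
have tQ : trivIset Q.
  apply/trivIsetP => O O'; rewrite !inE => /andP[/imsetP[a _ ->] _] /andP[/imsetP[b _ ->] _].
  apply: contraR => /pred0Pn[c /= /andP[]]; rewrite -!eq_porbit_mem => /eqP <- /eqP <-.
  by [].
have cQ : cover Q \subset Y.
  by apply/bigcupsP => O; rewrite inE => /andP[].
have QQ := @card_trivIset_le Q p K tQ.
have {}QQ := leq_trans (QQ _) (leq_add (subset_leq_card cQ) (leqnn _)).
rewrite (leq_trans (leq_mul (leqnn K) xE))// mulnDr addnAC leq_add2r.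
rewrite (leq_trans _ (QQ _)) ?leq_mul2l ?(leq_trans EA) ?sQ ?orbT// => l.
have [lT|lT] := ltnP l #|T|.+1.
  by have := Qp (Ordinal lT); rewrite leqNgt => /negbFE/ltnW.
rewrite (_ : [set _ in _ | _] = set0) ?cards0//; apply/setP => O; rewrite !inE.
by apply/negP => /andP[_ /eqP Ol]; have := max_card (mem O); rewrite Ol leqNgt lT.
Qed.
End ApproximateRoots.

(* Passage to the limit along the ultrafilter *)
From mathcomp Require Import all_classical all_reals all_analysis.
Import Order.TTheory GRing.Theory Num.Theory numFieldNormedType.Exports.

Lemma nonprincipal_setC1 (T : Type) (w : nonprincipalUltrafilter T) (t : T) :
  nuf_set w (~` [set t])%classic.
Proof.
have [wt|//] := in_ultra_setVsetC [set t]%classic (nuf_ultra w).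
case: (@nuf_nonprincipal _ w t); apply/seteqP; split=> A.
  move=> wA; have [u [/= ut Au]] := filter_ex (filterI wt wA).
  by apply/principal_filterP; rewrite -ut.
by move=> /principal_filterP At; apply: filterS wt => _ ->.
Qed.

Lemma nonprincipal_ge (w : nonprincipalUltrafilter posnat) (N : nat) :
  \forall n \near nuf_set w, (N <= val n)%N.
Proof.
elim: N => [|N IHN]; first exact: nearW.
have [[n nN]|nN] := pselect (exists n : posnat, val n = N); last first.
  apply: filterS IHN => n Nn; rewrite ltn_neqAle Nn andbT.
  by apply/eqP => Nn'; apply: nN; exists n.
apply: filterS2 IHN (nonprincipal_setC1 w n) => m Nm mn.
rewrite ltn_neqAle Nm andbT -nN; apply/eqP => /val_inj nm.
exact: mn.
Qed.

(** Left invariance of the distance, turning the coset relation into closeness of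
    representatives. *)
Lemma hammingVg (R : realType) n (f g : 'S_n) :
  hamming R (f^-1 * g)%g 1%g = hamming R f g.
Proof.
rewrite /hamming; congr (_%:R / _)%R; rewrite -[RHS](card_imset _ (@perm_inj _ f)).
apply: eq_card => a; rewrite -(permKV f a) mem_imset ?inE; last exact: perm_inj.
by rewrite permM permK perm1 eq_sym.
Qed.

Lemma approximate_root_seq (R : realType) (w : nonprincipalUltrafilter posnat)
    (p : nat) (f : permSeq) : (0 < p)%N ->
  exists x : permSeq,
    (hamming R (x n ^+ p)%g (f n) @[n --> nuf_set w] --> (0%R : R))%classic.
Proof.
move=> p0.
pose bad n (y : 'S_(val n)) := #|[set a | (y ^+ p)%g a != f n a]%SET|.
(* Minimizing the error gives one sequence that serves all [e], although the approximate root
   depends on [K], hence on [e]. *)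
exists (fun n => [arg min_(y < 1%g) bad n y]).
apply/cvgrPdist_le => e e0.
(* For [n] at least [K * p + K * K * p] the error is at most [2 * n / K], and [K > 2 / e]. *)
pose K := (Num.truncn (2 / e)%R).+1.
apply: filterS (nonprincipal_ge w (K * p + K * K * p)) => n nK.
rewrite sub0r normrN ger0_norm ?divr_ge0//.
have n0 : (0 < (val n)%:R :> R)%R by rewrite ltr0n (valP n).
rewrite ler_pdivrMr//.
case: arg_minnP => // y _ /= ymin.
have [//|x _ xE] := @approximate_root _ (f n) p K [set: 'I_(val n)] p0.
have {}xE : (K * bad n y <= 2 * val n)%N.
  apply: (@leq_trans (K * bad n x)); first by rewrite leq_mul2l ymin ?orbT.
  rewrite (_ : bad n x = #|[set a in [set: 'I_(val n)] | (x ^+ p)%g a != f n a]%SET|).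
    by apply: leq_trans xE _; rewrite cardsT card_ord -addnA mul2n -addnn leq_add2l.
  by apply: eq_card => a; rewrite !inE.
have eK : (2 <= e * K%:R)%R.
  by rewrite mulrC -ler_pdivrMr// ltW// truncnS_gt.
rewrite -(@ler_pM2l _ K%:R) ?ltr0n// -natrM.
apply: (@le_trans _ _ (2 * (val n)%:R)%R); first by rewrite -natrM ler_nat.
by rewrite mulrA ler_pM2r// [leRHS]mulrC.
Qed.

Lemma pi_quotX (G : groupType) (N : normalSubgroup G) (x : G) (n : nat) :
  (\pi_(quotGroup N) (x ^+ n)%g = (\pi_(quotGroup N) x : quotGroup N) ^+ n)%g%qT.
Proof.
elim: n => [//|n IHn].
by rewrite expgS pi_quot_mul IHn expgS.
Qed.

Theorem corollary1 (R : realType) (w : nonprincipalUltrafilter posnat)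
    (g : universalSofic R w) (p : nat) (p_gt0 : (0 < p)%N) :
  exists x : universalSofic R w, (x ^+ p)%g = g.
Proof.
elim/quotW: g => f.
have [x xf] := approximate_root_seq R w f p_gt0.
exists (\pi_(universalSofic R w) x)%qT.
(* It remains to see that the inverse of [x ^+ p] times [f] is a null sequence. *)
rewrite -pi_quotX; apply/eqmodP; rewrite /= /coset_rel; apply/asboolP.
have xX n : (x ^+ p)%g n = (x n ^+ p)%g.
  by elim: p {p_gt0 xf} => // p IHp; rewrite !expgS -IHp.
rewrite (_ : (fun n => _) = fun n => hamming R (x n ^+ p)%g (f n))//.
by apply/funext => n; rewrite -[RHS]hammingVg -xX.
Qed.
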